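(* Let $c>0$ and suppose that there is a function $\epsilon:\mathbb{N}\to\mathbb{R}_{\ge 0}$ with $\epsilon(n)\to 0$ such that $\mathrm{pdeg}(\mathrm{OR}_n)\le (\log n)^{c+\epsilon(n)}$ for all sufficiently large $n\in\mathbb{N}$. Then there is a function $\delta:\mathbb{N}\to\mathbb{R}_{\ge 0}$ with $\delta(n)\to 0$ such that for every $n$ (in the asymptotic sense, i.e. for the relevant large $n$) there exists a truly $n$-variate Boolean function $f:\{0,1\}^n\to\{0,1\}$ with $\mathrm{pdeg}(f)\le (\log n)^{c/(c+1)+\delta(n)}$.
   Context: For a Boolean function $f:\{0,1\}^n\to\{0,1\}$ and $\varepsilon\ge 0$, an $\varepsilon$-error probabilistic polynomial for $f$ is a random polynomial $\bm{P}$ over $\mathbb{R}[x_1,\ldots,x_n]$ (a probability distribution with finite support on real polynomials) such that for every $a\in\{0,1\}^n$, $\Pr_{\bm{P}}[\bm{P}(a)\neq f(a)]\le\varepsilon$. Its degree is at most $d$ if the distribution is supported on polynomials of degree at most $d$. The $\varepsilon$-error probabilistic degree $\mathrm{pdeg}_\varepsilon(f)$ is the least such $d$, and $\mathrm{pdeg}(f):=\mathrm{pdeg}_{1/3}(f)$. $\mathrm{OR}_n$ is the OR function on $n$ variables. A Boolean function $f$ depends on its variable $x_i$ if there is an input $a$ such that flipping the $i$-th bit of $a$ changes the value of $f$; $f:\{0,1\}^n\to\{0,1\}$ is truly $n$-variate if it depends on all $n$ of its variables. Logarithms are to base 2. *)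

(* Defs.v *)
From mathcomp Require Import all_boot all_order all_algebra.
From mathcomp Require Import finmap.
From mathcomp Require Import all_classical all_reals all_analysis.
(* The notations of mpoly clash with those of MathComp-Analysis:
   [mpoly n R] is the type written {mpoly R[n]} in the mpoly library. *)
From mathcomp Require Import -(notations) mpoly.

Set Implicit Arguments.
Unset Strict Implicit.
Unset Printing Implicit Defensive.

Import Order.TTheory GRing.Theory Num.Theory numFieldNormedType.Exports.
Local Open Scope fset_scope.
Local Open Scope ring_scope.

Definition cube (n : nat) : finType := {ffun 'I_n -> bool}.

Definition boolean_function (n : nat) := cube n -> bool.

Definition OR (n : nat) : boolean_function n := fun a => [exists i, a i].

Arguments OR n : clear implicits.

Definition flip (n : nat) (i : 'I_n) (a : cube n) : cube n :=
  [ffun j => if j == i then ~~ a j else a j].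

Definition depends_on (n : nat) (f : boolean_function n) (i : 'I_n) : Prop :=
  exists a : cube n, f (flip i a) <> f a.

Definition truly_variate (n : nat) (f : boolean_function n) : Prop :=
  forall i : 'I_n, depends_on f i.

Record random_poly (R : realType) (n : nat) := RandomPoly {
  rp_mass :> {fsfun mpoly n R -> R with 0};
  rp_mass_ge0 : forall p, 0 <= rp_mass p;
  rp_mass_sum1 : \sum_(p <- finsupp rp_mass) rp_mass p = 1 }.

Definition rp_prob (R : realType) (n : nat) (P : random_poly R n)
    (E : pred (mpoly n R)) : R :=
  \sum_(p <- finsupp P | E p) P p.

Definition eval_cube (R : realType) (n : nat) (p : mpoly n R) (a : cube n) : R :=
  meval (fun i => (a i)%:R) p.

Definition prob_poly_for (R : realType) (n : nat) (eps : R)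
    (f : boolean_function n) (P : random_poly R n) : Prop :=
  forall a : cube n, rp_prob P (fun p => eval_cube p a != (f a)%:R) <= eps.

(* [msize p] is the total degree plus one, and [msize 0 = 0]. *)
Definition rp_degree_le (R : realType) (n : nat) (P : random_poly R n)
    (d : nat) : Prop :=
  forall p, p \in finsupp P -> (msize p <= d.+1)%N.

Definition has_prob_poly (R : realType) (n : nat) (eps : R)
    (f : boolean_function n) (d : nat) : Prop :=
  exists P : random_poly R n, prob_poly_for eps f P /\ rp_degree_le P d.

(* Every Boolean function is the restriction to the cube of a polynomial, so a
   point mass is a probabilistic polynomial for it with error 0. *)
Section Existence.
Variables (R : realType) (n : nat).

Definition interp (f : boolean_function n) : mpoly n R :=
  \sum_(b : cube n | f b)
    \prod_(i < n) (if b i then mpolyX R (mnm1 i) else 1 - mpolyX R (mnm1 i)).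

Lemma eval_interp f (a : cube n) : eval_cube (interp f) a = (f a)%:R.
Proof.
pose g (b : cube n) : R := (b == a)%:R.
rewrite /eval_cube /interp raddf_sum (eq_bigr g) /=.
  have [fa|nfa] := boolP (f a).
    rewrite (bigD1 a)//= /g eqxx big1 ?addr0// => b /andP[_ /negPf ->//].
  by apply: big1 => b fb; rewrite /g; case: eqP fb nfa => [->->|].
move=> b _ /=; rewrite (big_morph _ (mevalM _) (meval1 _)) /g.
have [->|nba] := eqVneq b a.
  apply: big1 => i _; case: ifP => ai; first by rewrite mevalXU ai.
  by rewrite mevalB meval1 mevalXU ai subr0.
have [i bai] : exists i, b i != a i.
  apply/existsP; apply: contraNT nba; rewrite negb_exists => /forallP h.
  by apply/eqP/ffunP => i; apply/eqP/negPn.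
rewrite (bigD1 i)//=; case: ifP bai => bi.
  by rewrite mevalXU; case: (a i) => //= _; rewrite mul0r.
by rewrite mevalB meval1 mevalXU; case: (a i) => //= _; rewrite subrr mul0r.
Qed.

Definition point_mass_fun (p : mpoly n R) : {fsfun mpoly n R -> R with 0} :=
  [fsfun [fsfun of _ => 0] with p |-> 1].

Lemma finsupp_point_mass p : finsupp (point_mass_fun p) = [fset p].
Proof. by rewrite finsupp_with oner_eq0 finsupp0 fsetU0. Qed.

Lemma point_mass_ge0 p q : 0 <= point_mass_fun p q.
Proof. by rewrite fsfun_withE fsfun0E; case: ifP. Qed.

Lemma point_mass_sum1 p :
  \sum_(q <- finsupp (point_mass_fun p)) point_mass_fun p q = 1.
Proof. by rewrite finsupp_point_mass big_seq_fset1 fsfun_with. Qed.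

Definition point_mass p := RandomPoly (point_mass_ge0 p) (point_mass_sum1 p).

Lemma has_prob_poly_exists (eps : {nonneg R}) (f : boolean_function n) :
  exists d, `[< has_prob_poly eps%:num f d >].
Proof.
exists (msize (interp f)); apply/asboolP.
exists (point_mass (interp f)); split=> [a|p].
  rewrite /rp_prob /= finsupp_point_mass big_mkcond big_seq_fset1.
  by rewrite eval_interp eqxx /=.
by rewrite finsupp_point_mass inE => /eqP ->.
Qed.

End Existence.

Definition pdeg_err (R : realType) (eps : {nonneg R}) (n : nat)
    (f : boolean_function n) : nat :=
  ex_minn (has_prob_poly_exists eps f).

Definition pdeg (R : realType) (n : nat) (f : boolean_function n) : nat :=
  pdeg_err (3^-1%:nng : {nonneg R}) f.

Definition log2 (R : realType) (x : R) : R := ln x / ln 2.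

(* Main.v *)
Require Import Defs.
From mathcomp Require Import all_boot all_order all_algebra.
From mathcomp Require Import finmap.
From mathcomp Require Import all_classical all_reals all_analysis.
From mathcomp Require Import -(notations) mpoly.
From mathcomp Require Import zify ring lra.

(* Write L = log2 n and let the address variables be r blocks of m = 2^k bits.
   When every block has exactly one bit set, they select one of m^r >= n data
   bits, and the selected bit is a polynomial of degree r + 1.  The function is
   set to 0 when a block has two bits set, an OR of r * m^2 monomials of degree
   2 at most; a block without any bit set kills the polynomial by itself.  So
   one sample of the polynomial for OR suffices, the error stays 1/3, and the
   degree is at most 2 pdeg (OR (r * m^2)) + r + 1, about k^c + L / k.  The two
   terms balance at k = L^(1/(c+1)), which gives L^(c/(c+1)). *)

Set Implicit Arguments.
Unset Strict Implicit.
Unset Printing Implicit Defensive.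

Import Order.TTheory GRing.Theory Num.Theory numFieldNormedType.Exports.
Local Open Scope classical_set_scope.
Local Open Scope ring_scope.

(** * Degrees of products, sums and compositions of polynomials *)

Section Degree.
Variables (R : idomainType) (n : nat).
Implicit Types (p q : mpoly n R).

Lemma msizeM_le_deg p q a b :
  (msize p <= a.+1)%N -> (msize q <= b.+1)%N -> (msize (p * q) <= (a + b).+1)%N.
Proof.
move=> pa qb; have [->|p0] := eqVneq p 0; first by rewrite mul0r mmeasure0.
have [->|q0] := eqVneq q 0; first by rewrite mulr0 mmeasure0.
by rewrite msizeM //; move: pa qb; lia.
Qed.

Lemma msize_prod_le_deg (I : Type) (s : seq I) (P : pred I) (F : I -> mpoly n R)
    (d : I -> nat) :
  (forall i, P i -> (msize (F i) <= (d i).+1)%N) ->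
  (msize (\prod_(i <- s | P i) F i) <= (\sum_(i <- s | P i) d i).+1)%N.
Proof.
move=> Fd; elim/big_rec2: _ => [|i a p Pi IH]; first by rewrite mmeasure1.
exact: msizeM_le_deg (Fd _ Pi) IH.
Qed.

Lemma msize_sum_le (I : Type) (s : seq I) (P : pred I) (F : I -> mpoly n R) d :
  (forall i, P i -> (msize (F i) <= d)%N) ->
  (msize (\sum_(i <- s | P i) F i) <= d)%N.
Proof.
move=> Fd; elim/big_ind: _ => [|p q pd qd|i /Fd //]; first by rewrite mmeasure0.
by apply: leq_trans (mmeasureD_le _ _ _) _; rewrite geq_max pd.
Qed.

Lemma msize_exp_le_deg p k e :
  (msize p <= k.+1)%N -> (msize (p ^+ e) <= (k * e).+1)%N.
Proof.
move=> pk; elim: e => [|e IH]; first by rewrite expr0 mmeasure1.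
by rewrite exprS mulnS; exact: msizeM_le_deg.
Qed.

(** Expand [p] in monomials: substitution turns one of degree e into a product of degree at most
    [k * e]. *)
Lemma msize_comp_mpoly_le N (lq : N.-tuple (mpoly n R)) (p : mpoly N R) k d :
  (forall i, msize (tnth lq i) <= k.+1)%N -> (msize p <= d.+1)%N ->
  (msize (comp_mpoly lq p) <= (k * d).+1)%N.
Proof.
move=> lqk pd; rewrite comp_mpolyEX big_seq; apply: msize_sum_le => m mp.
apply: leq_trans (mmeasureZ_le _ _ _) _; rewrite comp_mpolyX.
have /leq_trans-> // : (msize (\prod_(i < N) tnth lq i ^+ m i)
    <= (\sum_(i < N) k * m i).+1)%N.
  by apply: msize_prod_le_deg => i _; exact: msize_exp_le_deg.
rewrite -big_distrr /= ltnS leq_mul2l -mdegE.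
by rewrite -ltnS (leq_trans (msize_mdeg_lt mp) pd) orbT.
Qed.

End Degree.

(** * Image of a random polynomial under a map *)

Section PushForward.
Variables (R : realType) (n k : nat) (g : mpoly n R -> mpoly k R).
Variable P : random_poly R n.
Local Open Scope fset_scope.

Definition push_fun : {fsfun mpoly k R -> R with 0} :=
  [fsfun q in g @` finsupp P => \sum_(p <- finsupp P | g p == q) P p | 0].

Lemma finsupp_push_sub : finsupp push_fun `<=` g @` finsupp P.
Proof. exact: finsupp_sub. Qed.

Lemma push_sum (E : pred (mpoly k R)) :
  \sum_(q <- finsupp push_fun | E q) push_fun q =
  \sum_(p <- finsupp P | E (g p)) P p.
Proof.
(* Only the inclusion of the support in the image is at hand, so the sum is extended by zeros to the
   whole image and then split along the fibres of [g]. *)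
rewrite big_mkcond (big_fset_incl _ finsupp_push_sub) /=; last first.
  by move=> q _ /fsfun_dflt ->; case: ifP.
rewrite [RHS]big_mkcond /= (partition_big_imfset _ g) /=.
rewrite [LHS]big_seq [RHS]big_seq; apply: eq_bigr => q qP.
rewrite fsfunE qP; case: ifP => Eq.
  by apply: eq_bigr => p /eqP ->; rewrite Eq.
by rewrite big1 // => p /eqP ->; rewrite Eq.
Qed.

Lemma push_ge0 q : 0 <= push_fun q.
Proof.
rewrite fsfunE; case: ifP => // _.
by apply: sumr_ge0 => p _; exact: rp_mass_ge0.
Qed.

Lemma push_sum1 : \sum_(q <- finsupp push_fun) push_fun q = 1.
Proof. by rewrite (push_sum xpredT) rp_mass_sum1. Qed.

Definition push := RandomPoly push_ge0 push_sum1.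

Lemma push_prob E : rp_prob push E = rp_prob P (fun p => E (g p)).
Proof. exact: push_sum. Qed.

Lemma push_degree_le d e :
  rp_degree_le P d ->
  (forall p, (msize p <= d.+1)%N -> (msize (g p) <= e.+1)%N) ->
  rp_degree_le push e.
Proof.
move=> Pd ge q /(fsubsetP finsupp_push_sub) /imfsetP[p /= pP ->].
by apply: ge; exact: Pd.
Qed.

End PushForward.

(** * Multiplication by the negation of an OR *)

Lemma rp_prob_le (R : realType) n (P : random_poly R n) (E F : pred (mpoly n R)) :
  (forall p, E p -> F p) -> rp_prob P E <= rp_prob P F.
Proof.
move=> EF; rewrite /rp_prob big_mkcond [leRHS]big_mkcond /=.
apply: ler_sum => p _; case: ifP => [/EF -> //|_].
by case: ifP => // _; exact: rp_mass_ge0.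
Qed.

(** Each sample [p] becomes [(1 - p(lq)) * S]. If [p] is right at [h a], the first factor is 0 when
    the OR holds, whatever [S] is there, and 1 otherwise, where [S] is right. So an error at [a]
    forces an error of [p] at [h a], and [eps] does not grow. *)
Lemma has_prob_poly_nor_mul (R : realType) (n N : nat) (eps : R)
    (f : boolean_function n) (h : cube n -> cube N)
    (lq : N.-tuple (mpoly n R)) (S : mpoly n R) (k s d : nat) :
  (forall a i, eval_cube (tnth lq i) a = (h a i)%:R) ->
  (forall i, msize (tnth lq i) <= k.+1)%N ->
  (msize S <= s.+1)%N ->
  (forall a, ~~ OR N (h a) -> eval_cube S a = (f a)%:R) ->
  (forall a, OR N (h a) -> f a = false) ->
  has_prob_poly eps (OR N) d -> has_prob_poly eps f (k * d + s).
Proof.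
move=> lqh lqk Ss Sf f0 [P [Peps Pd]].
pose g (p : mpoly N R) := (1 - comp_mpoly lq p) * S.
exists (push g P); split=> [a|]; last first.
  apply: push_degree_le Pd _ => p pd; apply: msizeM_le_deg Ss.
  apply: leq_trans (mmeasureD_le _ _ _) _.
  by rewrite mmeasure1 mmeasureN geq_max /=; exact: msize_comp_mpoly_le.
rewrite push_prob; apply: le_trans (Peps (h a)); apply: rp_prob_le => p.
apply: contraNN => /eqP pa; apply/eqP.
rewrite /eval_cube mevalM mevalB meval1 comp_mpoly_meval.
have -> : meval (fun i => meval (fun j => (a j)%:R) (tnth lq i)) p =
          eval_cube p (h a).
  by apply: meval_eq => i; rewrite -lqh.
rewrite pa; case: (boolP (OR N (h a))) => [/f0 ->|/Sf].
  by rewrite subrr mul0r.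
by rewrite subr0 mul1r.
Qed.

Lemma pdeg_prop (R : realType) n (f : boolean_function n) :
  has_prob_poly (3^-1 : R) f (pdeg R f).
Proof. by rewrite /pdeg /pdeg_err; case: ex_minnP => d /asboolP. Qed.

Lemma pdeg_le (R : realType) n (f : boolean_function n) d :
  has_prob_poly (3^-1 : R) f d -> (pdeg R f <= d)%N.
Proof.
by move=> fd; rewrite /pdeg /pdeg_err; case: ex_minnP => d' _; apply; exact/asboolP.
Qed.

(** * The address function: dependence on all variables, and degree *)

Section AddressFunction.
(** [phi] sends an address to the data bit it reads. Addresses may share a data bit, as [m ^ r] may
    exceed [D]; surjectivity ensures that each data bit is read. *)
Variables (r m D : nat) (phi : {ffun 'I_r -> 'I_m} -> 'I_D).
Hypothesis phi_surj : forall d, exists t, phi t = d.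

Local Notation var := ('I_r * 'I_m + 'I_D)%type.
Local Notation n := #|{: var}|.
Local Notation triple := ('I_r * 'I_m * 'I_m)%type.
Local Notation N := #|{: triple}|.
Local Notation value a v := (a (enum_rank (v : var))).

Definition selects (a : cube n) (t : {ffun 'I_r -> 'I_m}) :=
  [forall i, value a (inl (i, t i))].

(** Triples with [j = k] are kept as constantly false entries, so that the OR has exactly
    [r * m * m] inputs. *)
Definition collisions (a : cube n) : cube N :=
  [ffun u => let: (i, j, k) := enum_val u in
    [&& j != k, value a (inl (i, j)) & value a (inl (i, k))]].

Definition address_fun : boolean_function n := fun a =>
  ~~ OR N (collisions a) && [exists t, selects a t && value a (inr (phi t))].

Lemma no_collisionP a i j k : ~~ OR N (collisions a) ->
  value a (inl (i, j)) -> value a (inl (i, k)) -> j = k.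
Proof.
rewrite negb_exists => /forallP/(_ (enum_rank (i, j, k))).
by rewrite ffunE enum_rankK => + aj ak; rewrite aj ak /= andbT negbK => /eqP.
Qed.

Lemma selects_uniq a t t' : ~~ OR N (collisions a) ->
  selects a t -> selects a t' -> t = t'.
Proof.
move=> aN /forallP st /forallP st'; apply/ffunP => i.
exact: no_collisionP aN (st i) (st' i).
Qed.

Definition code (t : {ffun 'I_r -> 'I_m}) : cube n :=
  [ffun u => match enum_val u with
             | inl (i, j) => t i == j
             | inr d => phi t == d
             end].

Lemma address_fun_code t : address_fun (code t).
Proof.
apply/andP; split; last first.
  apply/existsP; exists t; apply/andP; split; last by rewrite ffunE enum_rankK.
  by apply/forallP => i; rewrite ffunE enum_rankK.
rewrite negb_exists; apply/forallP => u; rewrite ffunE.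
case: (enum_val u) => -[i j] k; rewrite !ffunE !enum_rankK.
by apply/negP => /and3P[/eqP jk /eqP tj /eqP tk]; apply: jk; rewrite -tj -tk.
Qed.

(** [code t] is a minimal true input. An address selected after clearing a bit is selected by
    [code t], hence equals [t]; but [t] needs every set bit, including the cleared one. *)
Lemma address_fun_flip_code t u : code t u -> ~~ address_fun (flip u (code t)).
Proof.
move=> tu; apply/negP => /andP[_ /existsP[t' /andP[/forallP st' dt']]].
(* Bit [u] was set, so the flip only clears it. *)
have sub w : flip u (code t) w -> code t w && (w != u).
  by rewrite ffunE; case: eqP => [->|_]; [rewrite tu|rewrite andbT].
have tt' : t = t'.
  apply/ffunP => i; have /sub/andP[] := st' i.
  by rewrite ffunE enum_rankK => /eqP.
move: tu; rewrite ffunE; case E : (enum_val u) => [[i j]|d] /eqP tE.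
  have /sub/andP[_ /eqP] := st' i; apply.
  by rewrite -tt' tE -E enum_valK.
by have /sub/andP[_ /eqP] := dt'; apply; rewrite -tt' tE -E enum_valK.
Qed.

Lemma address_fun_truly_variate : truly_variate address_fun.
Proof.
move=> u; suff [t tu] : exists t, code t u.
  exists (code t); rewrite address_fun_code.
  by rewrite (negbTE (address_fun_flip_code tu)).
case E : (enum_val u) => [[i j]|d].
  by exists [ffun=> j]; rewrite ffunE E ffunE.
by have [t td] := phi_surj d; exists t; rewrite ffunE E td.
Qed.

Variable R : realType.

Local Notation xvar v := (mpolyX R (mnm1 (enum_rank (v : var))) : mpoly n R).

Definition address_poly : mpoly n R :=
  \sum_(t : {ffun 'I_r -> 'I_m})
    (\prod_(i < r) xvar (inl (i, t i))) * xvar (inr (phi t)).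

Lemma msizeXU v : (msize (xvar v) <= 2)%N.
Proof. by rewrite msizeX mdeg1. Qed.

Lemma msize_address_poly : (msize address_poly <= r.+2)%N.
Proof.
apply: msize_sum_le => t _; rewrite -addn1.
apply: (msizeM_le_deg _ (msizeXU _)).
rewrite (_ : r.+1 = (\sum_(i < r) 1).+1)%N; last by rewrite sum1_card card_ord.
by apply: msize_prod_le_deg => i _; exact: msizeXU.
Qed.

Lemma eval_address_monomial a (t : {ffun _}) :
  eval_cube ((\prod_(i < r) xvar (inl (i, t i))) * xvar (inr (phi t))) a =
  (selects a t && value a (inr (phi t)))%:R.
Proof.
rewrite /eval_cube mevalM mevalXU (big_morph _ (mevalM _) (meval1 _)).
rewrite -mulnb natrM; congr (_ * _); rewrite /selects.
case: (boolP [forall i, _]) => [/forallP at1|]; last first.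
  by rewrite negb_forall => /existsP[i /negPf ai]; rewrite (bigD1 i) //= mevalXU ai mul0r.
by apply: big1 => i _; rewrite mevalXU at1.
Qed.

(** The polynomial counts the selected addresses whose data bit is set. Without collisions at most
    one address is selected, so the count is 0 or 1. *)
Lemma eval_address_poly a : ~~ OR N (collisions a) ->
  eval_cube address_poly a = (address_fun a)%:R.
Proof.
move=> aN; rewrite /address_fun aN /= /eval_cube raddf_sum /=.
case: (boolP [exists t, _]) => [/existsP[t /andP[st dt]]|]; last first.
  rewrite negb_exists => /forallP none; apply: big1 => t _.
  by rewrite [LHS]eval_address_monomial (negPf (none t)).
rewrite (bigD1 t) //= [X in _ + X]big1 ?addr0 => [|t' nt't].
  by rewrite [LHS]eval_address_monomial st dt.
rewrite [LHS]eval_address_monomial; case: (boolP (selects a t')) => //= st'.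
by rewrite (selects_uniq aN st' st) eqxx in nt't.
Qed.

Lemma pdeg_address_fun : (pdeg R address_fun <= 2 * pdeg R (OR N) + r.+1)%N.
Proof.
apply: pdeg_le.
(* The entries of [collisions] as monomials of degree 2, or 0 on the diagonal; this degree is the
   factor 2 of the bound. *)
pose lq := [tuple (let: (i, j, k) := enum_val u in
  if j != k then xvar (inl (i, j)) * xvar (inl (i, k)) else 0) | u < N].
apply: (@has_prob_poly_nor_mul _ _ _ _ _ collisions lq address_poly).
- move=> a u; rewrite tnth_mktuple ffunE; case: (enum_val u) => -[i j] k.
  case: eqP => _ /=; first by rewrite /eval_cube meval0.
  by rewrite /eval_cube mevalM !mevalXU -natrM mulnb.
- move=> u; rewrite tnth_mktuple; case: (enum_val u) => -[i j] k.
  case: eqP => _ /=; first by rewrite mmeasure0.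
  exact: (msizeM_le_deg (msizeXU _) (msizeXU _)).
- exact: msize_address_poly.
- exact: eval_address_poly.
- by move=> a; rewrite /address_fun => ->.
- exact: pdeg_prop.
Qed.

End AddressFunction.

(** The [r * m] address bits leave [n - r * m > 0] data bits, and [m ^ r] addresses suffice to reach
    them all. *)
Lemma exists_truly_variate_pdeg_le (R : realType) (r m n : nat) :
  (r * m < n)%N -> (n <= m ^ r)%N ->
  exists f : boolean_function n,
    truly_variate f /\ (pdeg R f <= 2 * pdeg R (OR (r * m * m)) + r.+1)%N.
Proof.
move=> rm_n n_mr; pose D := (n - r * m).-1.
have nE : n = #|{: 'I_r * 'I_m + 'I_D.+1}|.
  by rewrite card_sum card_prod !card_ord /D; lia.
have NE : (r * m * m)%N = #|{: 'I_r * 'I_m * 'I_m}| by rewrite !card_prod !card_ord.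
have DT : (D.+1 <= #|{: {ffun 'I_r -> 'I_m}}|)%N.
  by rewrite card_ffun !card_ord /D; lia.
(* Addresses are numbered by rank; [inord] sends the ranks above [D] to 0. *)
pose phi (t : {ffun 'I_r -> 'I_m}) : 'I_D.+1 := inord (enum_rank t).
have phi_surj d : exists t, phi t = d.
  by exists (enum_val (widen_ord DT d)); rewrite /phi enum_valK inord_val.
(* The body of [D] mentions [n], so it is forgotten before [n] is replaced by the cardinal that
   types [address_fun]. *)
rewrite {}NE {rm_n n_mr}; clearbody D; subst n.
exists (address_fun phi); split; first exact: address_fun_truly_variate.
exact: pdeg_address_fun.
Qed.

(** * Logarithms and real powers *)

Section LogPow.
Variable R : realType.
Implicit Types x y : R.

Lemma ln2_gt0 : 0 < ln 2 :> R.
Proof. by rewrite ln_gt0 // ltr1n. Qed.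

Lemma ler_log2 x y : 0 < x -> x <= y -> log2 x <= log2 y.
Proof.
move=> x0 xy; rewrite /log2 ler_pM2r ?invr_gt0 ?ln2_gt0 //.
by rewrite ler_ln ?posrE ?(lt_le_trans x0).
Qed.

Lemma log2M x y : 0 < x -> 0 < y -> log2 (x * y) = log2 x + log2 y.
Proof. by move=> x0 y0; rewrite /log2 lnM ?posrE // mulrDl. Qed.

Lemma log2_pow2 k : log2 ((2 ^ k)%N%:R : R) = k%:R.
Proof.
rewrite /log2 natrX lnXn ?ltr0n // -[ln 2 *+ k]mulr_natl mulfK //.
by rewrite gt_eqF // ln2_gt0.
Qed.

Lemma powR_ge1 x y : 1 <= x -> 0 <= y -> 1 <= x `^ y.
Proof. by move=> x1 y0; rewrite -(powRr0 x) ler_powR. Qed.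

Lemma ln_cvgry (T : Type) (F : set_system T) {FF : Filter F} (u : T -> R) :
  u x @[x --> F] --> +oo -> ln (u x) @[x --> F] --> +oo.
Proof.
move=> /cvgryPge uy; apply/cvgryPge => A.
near=> x; rewrite -[leLHS]expRK ler_ln ?posrE ?expR_gt0 //.
  by near: x; exact: uy.
by apply: lt_le_trans (expR_gt0 A) _; near: x; exact: uy.
Unshelve. all: by end_near. Qed.

Lemma powR_cvgry (T : Type) (F : set_system T) {FF : Filter F}
    (u : T -> R) x :
  0 < x -> u t @[t --> F] --> +oo -> u t `^ x @[t --> F] --> +oo.
Proof.
move=> x0 /cvgryPge uy; apply/cvgryPge => A; near=> t.
apply: le_trans (ler_norm A) _.
have -> : `|A| = (`|A| `^ x^-1) `^ x.
  by rewrite -powRrM mulVf ?gt_eqF // powRr1.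
have h : `|A| `^ x^-1 <= u t by near: t; exact: uy.
have u0 : 0 <= u t := le_trans (powR_ge0 _ _) h.
by apply: (ge0_ler_powR (ltW x0)) => //; rewrite nnegrE powR_ge0.
Unshelve. all: by end_near. Qed.

Lemma log2_cvgny : log2 (n%:R : R) @[n --> \oo] --> +oo.
Proof.
have /cvgryPge h : ln (n%:R : R) @[n --> \oo] --> +oo.
  exact: ln_cvgry cvgr_idn.
apply/cvgryPge => A; near=> n.
by rewrite /log2 ler_pdivlMr ?ln2_gt0 //; near: n; exact: h.
Unshelve. all: by end_near. Qed.

End LogPow.

(** * Choice of the block sizes and the resulting estimates *)

Section BlockSizes.
Variables (R : realType) (c : R).
Hypothesis c_gt0 : 0 < c.
Implicit Types L : R.

(** With [L] = log2 n, there are [blocks L] blocks of [2 ^ bits L] bits, and [pairs L] is the arity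
    of the OR. The successors round up, so that [bits L * blocks L] is at least [L]. *)
Definition bits L := (Num.truncn (L `^ (c + 1)^-1)).+1.
Definition blocks L := (Num.truncn (L `^ (c / (c + 1)))).+1.
Definition pairs L := (blocks L * 2 ^ bits L * 2 ^ bits L)%N.

Let c1_gt0 : 0 < c + 1. Proof. by rewrite addr_gt0. Qed.

Lemma powR_split L : 0 < L -> L = L `^ (c + 1)^-1 * L `^ (c / (c + 1)).
Proof.
move=> L0; rewrite -powRD ?(gt_eqF L0) ?implybT //.
have -> : (c + 1)^-1 + c / (c + 1) = 1 by field; rewrite gt_eqF.
by rewrite powRr1 // ltW.
Qed.

Lemma le_bits_blocks L : 1 <= L -> L <= (bits L * blocks L)%:R.
Proof.
move=> L1; rewrite natrM [leLHS]powR_split ?(lt_le_trans ltr01) //.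
by rewrite ler_pM ?powR_ge0 // ltW // truncnS_gt.
Qed.

Lemma bits_le L : 1 <= L -> (bits L)%:R <= 2 * L `^ (c + 1)^-1.
Proof.
move=> L1; have l1 : 1 <= L `^ (c + 1)^-1 by rewrite powR_ge1 // invr_ge0 ltW.
rewrite /bits -natr1 mulr_natl mulr2n lerD //.
by rewrite truncn_le (le_trans ler01).
Qed.

Lemma blocks_le L : 1 <= L -> (blocks L)%:R <= 2 * L `^ (c / (c + 1)).
Proof.
move=> L1.
have l1 : 1 <= L `^ (c / (c + 1)) by rewrite powR_ge1 // divr_ge0 // ltW.
rewrite /blocks -natr1 mulr_natl mulr2n lerD //.
by rewrite truncn_le (le_trans ler01).
Qed.

(** With l = L^(1/(c+1)), [blocks L] is at most 2 l^c, whose logarithm is 1 + c log2 l; the crude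
    bounds ln l < l and 1 <= l suffice. *)
Lemma log2_blocks_le L : 1 <= L ->
  log2 ((blocks L)%:R : R) <= (1 + c / ln 2) * L `^ (c + 1)^-1.
Proof.
move=> L1; set l := L `^ _.
have l1 : 1 <= l by rewrite powR_ge1 // invr_ge0 ltW.
have l0 : 0 < l by rewrite (lt_le_trans ltr01).
have lc : L `^ (c / (c + 1)) = l `^ c by rewrite /l -powRrM mulrC.
apply: (le_trans (ler_log2 _ (blocks_le L1))); first by rewrite ltr0n.
rewrite lc; clearbody l; rewrite log2M ?powR_gt0 // mulrDl mul1r lerD //.
  by rewrite /log2 divff ?gt_eqF ?ln2_gt0.
rewrite /log2 ln_powR mulrAC ler_pM2l ?divr_gt0 ?ln2_gt0 //.
exact/ltW/ln_sublinear.
Qed.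

(** The number of blocks contributes 1 + c / ln 2, and each of the two factors [2 ^ bits L]
    contributes 2. *)
Definition pairs_const : R := 5 + c / ln 2.

Lemma log2_pairs_le L : 1 <= L ->
  log2 ((pairs L)%:R : R) <= pairs_const * L `^ (c + 1)^-1.
Proof.
move=> L1; have := log2_blocks_le L1; have := bits_le L1.
rewrite /pairs !natrM !log2M ?mulr_gt0 ?ltr0n ?expn_gt0 //.
rewrite log2_pow2 /pairs_const => h1 h2.
lra.
Qed.

(** The first term bounds the OR part, using [e <= 1] to make the constant uniform; 3 is 2 from
    [blocks_le] plus 1 from the successor. *)
Definition degree_const : R := 2 * pairs_const `^ (c + 1) + 3.

Lemma degree_bound L e : 1 <= L -> 0 <= e <= 1 ->
  2 * log2 ((pairs L)%:R : R) `^ (c + e) + (blocks L).+1%:R <=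
  degree_const * L `^ (c / (c + 1) + e).
Proof.
move=> L1 /andP[e0 e1].
have L0 : 0 < L by rewrite (lt_le_trans ltr01).
have K1 : 1 <= pairs_const.
  by rewrite /pairs_const -[leLHS]addr0 lerD ?ler1n // divr_ge0 ?ltW ?ln2_gt0.
have N1 : 1 <= (pairs L)%:R :> R by rewrite ler1n !muln_gt0 expn_gt0.
have B : log2 ((pairs L)%:R : R) `^ (c + e) <=
         pairs_const `^ (c + 1) * L `^ (c / (c + 1) + e).
  apply: (@le_trans _ _ ((pairs_const * L `^ (c + 1)^-1) `^ (c + e))).
    apply: ge0_ler_powR; rewrite ?nnegrE ?addr_ge0 ?(ltW c_gt0) //.
    - by rewrite divr_ge0 ?ln_ge0 // ler1n.
    - by rewrite mulr_ge0 ?powR_ge0 // (le_trans ler01).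
    - exact: log2_pairs_le.
  rewrite powRM ?powR_ge0 ?(le_trans ler01 K1) //.
  rewrite ler_pM ?powR_ge0 //; first by rewrite ler_powR // lerD2l.
  (* The exponent (c + e) / (c + 1) is at most c / (c + 1) + e. *)
  rewrite -powRrM ler_powR // mulrDr lerD // 1?mulrC //.
  rewrite -[leRHS]mulr1 ler_wpM2l // invf_le1 // lerDr ltW //.
have A : L `^ (c / (c + 1)) <= L `^ (c / (c + 1) + e) by rewrite ler_powR // lerDl.
have A1 : 1 <= L `^ (c / (c + 1)) by rewrite powR_ge1 // divr_ge0 // ltW.
have := blocks_le L1; rewrite -natr1 /degree_const.
lra.
Qed.

(** The logarithm of [pairs L] is O(L^(1/(c+1))), which falls below [L] once L^(c/(c+1)) exceeds the
    constant. *)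
Lemma pairs_lt L n : 1 <= L -> pairs_const < L `^ (c / (c + 1)) ->
  L = log2 (n%:R : R) -> (pairs L < n)%N.
Proof.
move=> L1 KL Ln; rewrite ltnNge; apply/negP => nN.
have n0 : (0 < n)%N.
  (* By convention [ln 0] is 0, which contradicts [1 <= L]. *)
  rewrite lt0n; apply/eqP => n0.
  by move: L1; rewrite Ln n0 /log2 ln0 // mul0r ler10.
have := log2_pairs_le L1; apply/negP; rewrite -ltNge.
apply: (@lt_le_trans _ _ L); last first.
  by rewrite [leLHS]Ln ler_log2 ?ltr0n ?ler_nat.
have L0 : 0 < L by rewrite (lt_le_trans ltr01).
by rewrite [ltRHS]powR_split // mulrC ltr_pM2l ?powR_gt0.
Qed.

Lemma le_expn_blocks L n : 1 <= L -> L = log2 (n%:R : R) ->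
  (n <= (2 ^ bits L) ^ blocks L)%N.
Proof.
move=> L1 Ln; have [->//|n0] := posnP n.
rewrite -expnM -(ler_nat R) -ler_ln ?posrE ?ltr0n ?expn_gt0 //.
rewrite -(@ler_pM2r _ (ln 2)^-1) ?invr_gt0 ?ln2_gt0 //.
by have := le_bits_blocks L1; rewrite {1}Ln -(@log2_pow2 R (_ * _)%N).
Qed.

Lemma le_pairs L : L `^ (c + 1)^-1 <= (pairs L)%:R.
Proof.
apply: le_trans (ltW (truncnS_gt _)) _; rewrite -/(bits L) ler_nat.
apply: leq_trans (ltnW (ltn_expl (bits L) (ltnSn 1))) _.
by rewrite /pairs leq_pmull // muln_gt0 expn_gt0.
Qed.

(** The assumption on OR holds only for large arities and is applied at this one. *)
Lemma pairs_cvgny : pairs (log2 n%:R) @[n --> \oo] --> \oo.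
Proof.
have e0 : 0 < (c + 1)^-1 by rewrite invr_gt0.
have /cvgryPge h : log2 (n%:R : R) `^ (c + 1)^-1 @[n --> \oo] --> +oo.
  exact: powR_cvgry e0 (@log2_cvgny R).
apply/(@cvgrnyP R)/cvgryPge => A; near=> n.
by apply: le_trans (le_pairs _); near: n; exact: h.
Unshelve. all: by end_near. Qed.

End BlockSizes.

(** * Asymptotic conclusion *)

Theorem theorem2 (R : realType) (c : R) (c_gt0 : 0 < c) :
  (exists eps : nat -> R,
     [/\ forall n, 0 <= eps n,
         eps n @[n --> \oo] --> (0 : R) &
         \forall n \near \oo,
           (pdeg R (OR n))%:R <= log2 (n%:R : R) `^ (c + eps n)]) ->
  exists delta : nat -> R,
    [/\ forall n, 0 <= delta n,
        delta n @[n --> \oo] --> (0 : R) &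
        \forall n \near \oo,
          exists f : boolean_function n,
            truly_variate f /\
            (pdeg R f)%:R <= log2 (n%:R : R) `^ (c / (c + 1) + delta n)].
Proof.
move=> [eps [eps0 eps_cvg pdegOR]].
pose L n : R := log2 (n%:R : R).
have Ly : L n @[n --> \oo] --> +oo := @log2_cvgny R.
have LyP A : \forall n \near \oo, A <= L n by have /cvgryPge := Ly; apply.
have Ny : pairs c (L n) @[n --> \oo] --> \oo := pairs_cvgny c_gt0.
have epsN : eps (pairs c (L n)) @[n --> \oo] --> (0 : R).
  exact: cvg_comp Ny eps_cvg.
(* The second summand absorbs the constant C = [degree_const c], since L^(ln C / ln L) = C; the
   absolute value keeps it nonnegative for small [n] too. *)
exists (fun n => eps (pairs c (L n)) + `|ln (degree_const c) / ln (L n)|).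
split=> [n||]; first by rewrite addr_ge0.
  rewrite -[0]addr0; apply: cvgD => //; apply/norm_cvg0P.
  rewrite -[0](mulr0 (ln (degree_const c))); apply: cvgMr.
  have lnLy : ln (L n) @[n --> \oo] --> +oo by exact: ln_cvgry Ly.
  have posL : \forall n \near \oo, 0 < ln (L n).
    by near=> n; rewrite ln_gt0 // (@lt_le_trans _ _ 2) ?ltr1n //; near: n.
  exact: (gtr0_cvgV0 posL).2 lnLy.
have /cvgryPgt powLy : L n `^ (c / (c + 1)) @[n --> \oo] --> +oo.
  by apply: powR_cvgry Ly; rewrite divr_gt0 ?addr_gt0.
near=> n.
have L2 : 2 <= L n by near: n.
have L1 : 1 <= L n by apply: le_trans L2; rewrite ler1n.
have lnL0 : 0 < ln (L n) by rewrite ln_gt0 // (lt_le_trans _ L2) ?ltr1n.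
have Nn : (pairs c (L n) < n)%N.
  apply: (pairs_lt c_gt0 L1) => //.
  by near: n; exact: powLy.
have [f [fn fd]] : exists f : boolean_function n, truly_variate f /\
    (pdeg R f <= 2 * pdeg R (OR (pairs c (L n))) + (blocks c (L n)).+1)%N.
  apply: exists_truly_variate_pdeg_le; last exact: le_expn_blocks.
  by apply: leq_ltn_trans Nn; rewrite leq_pmulr // expn_gt0.
exists f; split=> //.
have C1 : 1 <= degree_const c.
  by rewrite -[leLHS]add0r lerD ?ler1n // mulr_ge0 ?powR_ge0.
have L0 : 0 < L n by rewrite (lt_le_trans ltr01).
have eps1 : 0 <= eps (pairs c (L n)) <= 1.
  by rewrite eps0 /=; near: n; exact: (cvgr_le _ epsN).
have pN : (pdeg R (OR (pairs c (L n))))%:R <=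
    log2 ((pairs c (L n))%:R : R) `^ (c + eps (pairs c (L n))).
  (* The assumption on OR, pulled back along the divergent arity. *)
  by near: n; exact: Ny pdegOR.
rewrite (le_trans (_ : _ <= (2 * pdeg R (OR (pairs c (L n))) + (blocks c (L n)).+1)%:R)) //.
  by rewrite ler_nat.
rewrite natrD natrM (le_trans (_ : _ <=
  2 * log2 ((pairs c (L n))%:R : R) `^ (c + eps (pairs c (L n))) + (blocks c (L n)).+1%:R)) //.
  by rewrite lerD2r ler_wpM2l.
apply: le_trans (degree_bound c_gt0 L1 eps1) _.
(* After cancelling the common power of [L n], it remains to compare C with L^|ln C / ln L|; by
   [1 <= C] the absolute value drops and the logarithms agree. *)
rewrite addrA [leRHS]powRD ?(gt_eqF L0) ?implybT // mulrC ler_wpM2l ?powR_ge0 //.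
have C0 : 0 < degree_const c by rewrite (lt_le_trans ltr01).
rewrite -ler_ln ?posrE ?powR_gt0 // ln_powR.
by rewrite ger0_norm ?divr_ge0 ?ln_ge0 // divfK // gt_eqF.
Unshelve. all: by end_near. Qed.
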